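(* Let $V$ be a $3$-dimensional vector space over a field $K$, equipped with a bracket (a nonzero alternating trilinear form) $[\cdot\,\cdot\,\cdot]$, and consider the Grassmann–Cayley algebra of step $3$ on $V$, with join $\vee$ and meet $\wedge$ as described in the context. Then for all vectors $a,b,c,a',b',c'\in V$, $$(bc' \wedge b'c) \vee (ca' \wedge c'a) \vee (ab' \wedge a'b) = (c'b \wedge b'c) \vee (ca' \wedge ab) \vee (ab' \wedge a'c').$$
   Context: Grassmann–Cayley algebra of step $3$: the exterior algebra of a $3$-dimensional vector space $V$ over a field $K$, with a fixed bracket $[xyz]$ (a nonzero alternating trilinear form on $V$, e.g. the determinant in a fixed basis). The join $\vee$ is the exterior product; juxtaposition $xy$ denotes the join $x\vee y$ of two vectors (an extensor of step $2$, representing the line through the points $x,y$). The join of three vectors is identified with the scalar $x\vee y\vee z=[xyz]$. The meet of two step-$2$ extensors is the vector $$xy \wedge zw = [xyw]\,z - [xyz]\,w$$ (representing the intersection point of the two lines). Thus each side of the identity is the join of three vectors, i.e. the scalar $[pqr]$ where $p,q,r$ are the three meets. *)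

(* Defs.v *)
From HB Require Import structures.
From mathcomp Require Import all_boot all_order all_algebra.

Set Implicit Arguments.
Unset Strict Implicit.
Unset Printing Implicit Defensive.

Import GRing.Theory.
Local Open Scope ring_scope.

Record is_bracket (K : fieldType) (V : vectType K) (br : V -> V -> V -> K) :
    Prop := IsBracket {
  bracket_linear1 : forall y z : V, scalar (fun x : V => br x y z);
  bracket_linear2 : forall x z : V, scalar (fun y : V => br x y z);
  bracket_linear3 : forall x y : V, scalar (fun z : V => br x y z);
  bracket_alt12 : forall x y : V, br x x y = 0;
  bracket_alt23 : forall x y : V, br x y y = 0;
  bracket_alt13 : forall x y : V, br x y x = 0;
  bracket_neq0 : exists x y z : V, br x y z != 0
}.

(* The meet xy /\ zw of the step-2 extensors xy and zw, written on their       *)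
(* factors.  For a bracket br the formula is bilinear and alternating in       *)
(* (x, y) and in (z, w), so the value depends only on the exterior products    *)
(* xy and zw.                                                                  *)
Definition gc_meet (K : fieldType) (V : vectType K) (br : V -> V -> V -> K)
    (x y z w : V) : V :=
  br x y w *: z - br x y z *: w.

(* The join of three vectors under the identification of the top exterior      *)
(* power with K given by the bracket.                                          *)
Definition gc_join3 (K : fieldType) (V : vectType K) (br : V -> V -> V -> K)
    (p q r : V) : K :=
  br p q r.

(* Main.v *)
(** Write p, q, r for the meets on the left and p', q', r' for those on the
    right.  Then p' = -p, and Cramer's rule puts p on the line bc', so it is
    enough to show [xqr] + [xq'r'] = 0 for x = b and x = c'.  Each of these
    follows from two three-term Grassmann-Plücker relations. *)
Require Import Defs.
From HB Require Import structures.
From mathcomp Require Import all_boot all_order all_algebra.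
From mathcomp Require Import ring.

Set Implicit Arguments.
Unset Strict Implicit.
Unset Printing Implicit Defensive.

Import GRing.Theory.
Local Open Scope ring_scope.

Section BracketTheory.

Variables (K : fieldType) (V : vectType K) (br : V -> V -> V -> K).
Hypothesis br_bracket : is_bracket br.

Lemma bracketDl (x x' y z : V) : br (x + x') y z = br x y z + br x' y z.
Proof.
by have := bracket_linear1 br_bracket y z 1 x x'; rewrite /= scale1r mul1r.
Qed.

Lemma bracketDm (x y y' z : V) : br x (y + y') z = br x y z + br x y' z.
Proof.
by have := bracket_linear2 br_bracket x z 1 y y'; rewrite /= scale1r mul1r.
Qed.

Lemma bracketDr (x y z z' : V) : br x y (z + z') = br x y z + br x y z'.
Proof.
by have := bracket_linear3 br_bracket x y 1 z z'; rewrite /= scale1r mul1r.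
Qed.

Lemma bracketC12 (x y z : V) : br x y z = - br y x z.
Proof.
have := bracket_alt12 br_bracket (x + y) z.
rewrite !(bracketDl, bracketDm) !(bracket_alt12 br_bracket) add0r addr0.
by move/eqP; rewrite addr_eq0 => /eqP.
Qed.

Lemma bracketC23 (x y z : V) : br x y z = - br x z y.
Proof.
have := bracket_alt23 br_bracket x (y + z).
rewrite !(bracketDm, bracketDr) !(bracket_alt23 br_bracket) add0r addr0.
by move/eqP; rewrite addr_eq0 => /eqP.
Qed.

Lemma bracket0l (y z : V) : br 0 y z = 0.
Proof. by apply: (addrI (br 0 y z)); rewrite -bracketDl !addr0. Qed.

Lemma bracketZl (k : K) (x y z : V) : br (k *: x) y z = k * br x y z.
Proof.
have := bracket_linear1 br_bracket y z k x 0.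
by rewrite /= bracket0l !addr0.
Qed.

Lemma bracketZm (k : K) (x y z : V) : br x (k *: y) z = k * br x y z.
Proof. by rewrite bracketC12 bracketZl bracketC12 mulrN opprK. Qed.

Lemma bracketZr (k : K) (x y z : V) : br x y (k *: z) = k * br x y z.
Proof. by rewrite bracketC23 bracketZm bracketC23 mulrN opprK. Qed.

Lemma bracketNl (x y z : V) : br (- x) y z = - br x y z.
Proof. by rewrite -scaleN1r bracketZl mulN1r. Qed.

Lemma bracketNm (x y z : V) : br x (- y) z = - br x y z.
Proof. by rewrite -scaleN1r bracketZm mulN1r. Qed.

Lemma bracketNr (x y z : V) : br x y (- z) = - br x y z.
Proof. by rewrite -scaleN1r bracketZr mulN1r. Qed.

Definition bracket_linE :=
  (bracketDl, bracketDm, bracketDr, bracketNl, bracketNm, bracketNr,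
   bracketZl, bracketZm, bracketZr).

(** Of the 27 terms of the trilinear expansion, 21 repeat a vector and vanish; the other six are
    [br e0 e1 e2] up to the sign of a permutation. Hence the bracket is a fixed multiple of the
    coordinate determinant. *)
Lemma bracket_comb3 (e0 e1 e2 : V) (x0 x1 x2 y0 y1 y2 z0 z1 z2 : K) :
  br (x0 *: e0 + x1 *: e1 + x2 *: e2) (y0 *: e0 + y1 *: e1 + y2 *: e2)
     (z0 *: e0 + z1 *: e1 + z2 *: e2)
  = (x0 * (y1 * z2 - y2 * z1) - x1 * (y0 * z2 - y2 * z0)
     + x2 * (y0 * z1 - y1 * z0)) * br e0 e1 e2.
Proof.
rewrite !bracket_linE !(bracket_alt12 br_bracket) !(bracket_alt13 br_bracket).
rewrite !(bracket_alt23 br_bracket).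
rewrite (bracketC12 e1 e0) (bracketC23 e0 e2) (bracketC12 e2 e0).
rewrite (bracketC23 e0 e2) (bracketC23 e1 e2) (bracketC12 e1 e0).
rewrite (bracketC12 e2 e1) (bracketC23 e1 e2) (bracketC12 e1 e0).
ring.
Qed.

Hypothesis dimV : \dim (fullv : {vspace V}) = 3%N.

Lemma bracket_cramer (x y z w : V) :
  br y z w *: x - br x z w *: y + br x y w *: z - br x y z *: w = 0.
Proof.
(* The length of [vbasis] is part of its type, so the basis is generalized before [dimV] turns that
   length into 3. *)
have := vbasisP (fullv : {vspace V}); move: (vbasis _); rewrite dimV => e eP.
pose f0 := coord e ord0; pose f1 := coord e (lift ord0 ord0).
pose f2 := coord e (lift ord0 (lift ord0 ord0)).
have coordE u : u = f0 u *: e`_0 + f1 u *: e`_1 + f2 u *: e`_2.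
  by rewrite {1}(coord_basis eP (memvf u)) !big_ord_recl big_ord0 addr0 addrA.
have [d brE] : exists d, forall u v t, br u v t =
    (f0 u * (f1 v * f2 t - f2 v * f1 t) - f1 u * (f0 v * f2 t - f2 v * f0 t)
     + f2 u * (f0 v * f1 t - f1 v * f0 t)) * d.
  exists (br e`_0 e`_1 e`_2) => u v t.
  by rewrite {1}(coordE u) {1}(coordE v) {1}(coordE t) bracket_comb3.
rewrite [LHS]coordE /f0 /f1 /f2 !(linearD, linearN, linearZ) /= !brE.
(* Each coordinate is, up to the factor [d], the Laplace expansion of a 4 by 4 determinant with two
   equal rows. *)
by do 3![rewrite [X in X *: _](_ : _ = 0) ?scale0r ?add0r; last by ring].
Qed.

(** Apply [br a x] to the Cramer relation of [y], [z], [w], [a]: the term in [a] dies, leaving three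
    products. *)
Lemma bracket_plucker (a x y z w : V) :
  br a x y * br a z w - br a x z * br a y w + br a x w * br a y z = 0.
Proof.
have := congr1 (br a x) (bracket_cramer y z w a).
rewrite !bracket_linE (bracket_alt13 br_bracket) mulr0 subr0.
rewrite -(scale0r a) bracketZr mul0r => <-.
rewrite !(bracketC23 _ _ a) !(bracketC12 _ a).
by ring.
Qed.

Lemma gc_meetC (x y z w : V) : gc_meet br y x z w = - gc_meet br x y z w.
Proof.
by rewrite /gc_meet (bracketC12 y) (bracketC12 y) !scaleNr -opprD.
Qed.

(** The two expressions of the intersection point, on the line [zw] and on the line [xy], differ by
    exactly the Cramer relation. *)
Lemma gc_meet_left (x y z w : V) :
  gc_meet br x y z w = br x z w *: y - br y z w *: x.
Proof.
apply/eqP; rewrite -subr_eq0 -(bracket_cramer x y z w) /gc_meet opprB.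
by rewrite addrC !addrA.
Qed.

Variables a b c a' b' c' : V.

Let q := gc_meet br c a' c' a.
Let r := gc_meet br a b' a' b.
Let q' := gc_meet br c a' a b.
Let r' := gc_meet br a b' a' c'.

(** These swaps sort bracket entries in the order [a], [b], [c], [a'], [b'], [c'], so that [ring]
    sees equal brackets as equal atoms. Only specific instances are listed, since the general swaps
    would rewrite forever. *)
Let sortE :=
  (bracketC12 a' a b, bracketC23 a a' b, bracketC12 a' a c, bracketC23 a a' c,
   bracketC12 a' a c', bracketC12 a' c c', bracketC23 a b' b,
   bracketC23 a b' a', bracketC23 c a' a, bracketC12 c a a',
   bracketC23 c a' b, bracketC12 c b a', bracketC12 b a a', bracketC12 b a c',
   bracketC12 a' b c, bracketC23 b a' c, bracketC12 a' b c', bracketC23 b c' a',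
   bracketC12 c' a a', bracketC23 a c' a', bracketC12 c' a b,
   bracketC23 a c' b, bracketC12 c' b a').

(** In [br b q r] the [b]-part of [r] drops out, leaving [br a b b'] times two terms of the Plücker
    relation centred at [a']. In [br b q' r'] the [b]-part of [q'] drops out, leaving [br a' b c]
    times two terms of the one centred at [a], up to sign. The third terms of the two relations, so
    weighted, cancel. *)
Lemma bracket_meets_left : br b q r + br b q' r' = 0.
Proof.
transitivity
  (br a b b' * (br a' a b * br a' c c' - br a' a c * br a' b c'
                + br a' a c' * br a' b c)
   - br a' b c * (br a b a' * br a b' c' - br a b b' * br a a' c'
                  + br a b c' * br a a' b')); last first.
  by rewrite !bracket_plucker !mulr0 subr0.
rewrite /q /r /q' /r' /gc_meet !bracket_linE.
rewrite !(bracket_alt12 br_bracket, bracket_alt13 br_bracket,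
          bracket_alt23 br_bracket) !sortE.
by ring.
Qed.

(** The same two Plücker relations serve with exchanged roles: the [c']-parts of [q] and [r'] drop
    out, which produces the factors [br a' c c'] and [br a b' c']. *)
Lemma bracket_meets_right : br c' q r + br c' q' r' = 0.
Proof.
transitivity
  (br a' c c' * (br a b a' * br a b' c' - br a b b' * br a a' c'
                 + br a b c' * br a a' b')
   - br a b' c' * (br a' a b * br a' c c' - br a' a c * br a' b c'
                   + br a' a c' * br a' b c)); last first.
  by rewrite !bracket_plucker !mulr0 subr0.
rewrite /q /r /q' /r' /gc_meet !bracket_linE.
rewrite !(bracket_alt12 br_bracket, bracket_alt13 br_bracket,
          bracket_alt23 br_bracket) !sortE.
by ring.
Qed.

End BracketTheory.

Theorem theorem1 (K : fieldType) (V : vectType K)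
    (dimV : \dim (fullv : {vspace V}) = 3%N)
    (br : V -> V -> V -> K) (br_bracket : is_bracket br)
    (a b c a' b' c' : V) :
  gc_join3 br (gc_meet br b c' b' c) (gc_meet br c a' c' a) (gc_meet br a b' a' b)
  = gc_join3 br (gc_meet br c' b b' c) (gc_meet br c a' a b) (gc_meet br a b' a' c').
Proof.
rewrite /gc_join3 (gc_meetC br_bracket b c') (bracketNl br_bracket).
(* The first meet becomes a combination of [c'] and [b], the same in both brackets, so the sum can
   be grouped by its two coefficients. *)
apply/eqP; rewrite -addr_eq0 (gc_meet_left br_bracket dimV b c').
rewrite !(bracketDl br_bracket) !(bracketNl br_bracket) !(bracketZl br_bracket).
rewrite addrACA -mulrDr -opprD -mulrDr.
by rewrite bracket_meets_left // bracket_meets_right // !mulr0 subr0.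
Qed.
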